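(* The ring $\mathrm{Reg}^\circ([0,1],\mathbb{R})$ is real closed. Furthermore, $\mathrm{Sper}(\mathrm{Reg}^\circ([0,1],\mathbb{R}))$ and $\mathrm{Spec}(\mathrm{Reg}^\circ([0,1],\mathbb{R}))$ are homeomorphic. At last, the set $\mathrm{Sperm}(\mathrm{Reg}([0,1],\mathbb{R}))$ of closed points of $\mathrm{Sper}(\mathrm{Reg}([0,1],\mathbb{R}))$ and $\mathrm{Specm}(\mathrm{Reg}([0,1],\mathbb{R}))$ are equal as sets.
   Context: $\mathrm{Reg}([0,1],\mathbb{R})$ is the ring (pointwise operations) of all functions $f:[0,1]\to\mathbb{R}$ such that $f(c+)=\lim_{x\to c,\,x>c}f(x)$ exists in $\mathbb{R}$ for every $c\in[0,1)$ and $f(c-)=\lim_{x\to c,\,x<c}f(x)$ exists in $\mathbb{R}$ for every $c\in(0,1]$. $\mathrm{Reg}^\circ([0,1],\mathbb{R})$ is the subring of those functions with only finitely many discontinuities. $\mathrm{Spec}(R)$ is the prime spectrum of a commutative ring $R$ with the Zariski topology, $\mathrm{Specm}(R)$ the set of maximal ideals with the subspace topology, $\mathrm{Sper}(R)$ the real spectrum of $R$ (with its usual spectral topology), and $\mathrm{Sperm}(R)$ the set of closed points of $\mathrm{Sper}(R)$. ''Equal as sets'' means that there is a one-to-one correspondence between them. A ring $R$ is called real closed if: (a) the set of squares of $R$ is the set of non-negative elements of a partial order $\le$ on $R$, and $R$ together with $\le$ is an f-ring; (b) for all $a,b\in R$, if $0\le a\le b$, then $b\mid a^2$; (c) for every $\mathfrak{p}\in\mathrm{Spec}(R)$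 the ring $R/\mathfrak{p}$ is integrally closed and the field of fractions of $R/\mathfrak{p}$ is real closed. *)

(* Defs.v *)
From HB Require Import structures.
From mathcomp Require Import all_boot all_order all_algebra.
From mathcomp Require Import all_classical all_reals all_analysis.
Import Order.TTheory GRing.Theory Num.Theory.
Import numFieldNormedType.Exports.

Set Implicit Arguments.
Unset Strict Implicit.
Unset Printing Implicit Defensive.

Local Open Scope classical_set_scope.
Local Open Scope ring_scope.

(** * The rings Reg([0,1], R) and Reg°([0,1], R) *)

(* The subtype [0,1] of R; as a [set_type] it carries the topology induced
   from R, so that neighbourhoods of the endpoints are one-sided. *)
Notation unit_itv R := (set_type (`[0, 1]%classic : set R)).

Section Regulated.
Variable R : realType.
Implicit Types (f g : unit_itv R -> R) (c : unit_itv R).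

Definition right_nbhs c : set_system (unit_itv R) :=
  within [set x : unit_itv R | \val c < \val x] (nbhs c).

Definition left_nbhs c : set_system (unit_itv R) :=
  within [set x : unit_itv R | \val x < \val c] (nbhs c).

Definition regulated f : Prop :=
  (forall c, \val c < 1 -> exists l : R, f @ right_nbhs c --> l) /\
  (forall c, 0 < \val c -> exists l : R, f @ left_nbhs c --> l).

Definition discontinuities f : set (unit_itv R) :=
  [set c | ~ {for c, continuous f}].

Definition reg_pred : {pred (unit_itv R -> R)} :=
  fun f => `[< regulated f >].

Definition rego_pred : {pred (unit_itv R -> R)} :=
  fun f => `[< regulated f /\ finite_set (discontinuities f) >].

Lemma regulated_cst (k : R) : regulated (cst k).
Proof. by split=> c _; exists k; apply: cvg_cst; exact: within_filter. Qed.

Lemma regulatedB f g : regulated f -> regulated g -> regulated (f - g).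
Proof.
move=> [fr fl] [gr gl]; split=> c hc.
- have [[l fcl] [m gcm]] := (fr c hc, gr c hc).
  by exists (l - m); exact: (cvgB fcl gcm).
- have [[l fcl] [m gcm]] := (fl c hc, gl c hc).
  by exists (l - m); exact: (cvgB fcl gcm).
Qed.

Lemma regulatedM f g : regulated f -> regulated g -> regulated (f * g).
Proof.
move=> [fr fl] [gr gl]; split=> c hc.
- have [[l fcl] [m gcm]] := (fr c hc, gr c hc).
  by exists (l * m); exact: (cvgM fcl gcm).
- have [[l fcl] [m gcm]] := (fl c hc, gl c hc).
  by exists (l * m); exact: (cvgM fcl gcm).
Qed.

Lemma discontinuities_cst (k : R) : discontinuities (cst k) = set0.
Proof.
by apply/seteqP; split=> // c /=; apply; apply: cvg_cst; exact: nbhs_filter.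
Qed.

Lemma discontinuitiesB f g :
  discontinuities (f - g) `<=` discontinuities f `|` discontinuities g.
Proof.
move=> c /= nc; apply: contrapT => /not_orP[/contrapT cf /contrapT cg].
by apply: nc; exact: (cvgB cf cg).
Qed.

Lemma discontinuitiesM f g :
  discontinuities (f * g) `<=` discontinuities f `|` discontinuities g.
Proof.
move=> c /= nc; apply: contrapT => /not_orP[/contrapT cf /contrapT cg].
by apply: nc; exact: (cvgM cf cg).
Qed.

Lemma reg_subring_closed : subring_closed reg_pred.
Proof.
split; first by apply/asboolP; exact: regulated_cst.
- by move=> f g /asboolP rf /asboolP rg; apply/asboolP; exact: regulatedB.
- by move=> f g /asboolP rf /asboolP rg; apply/asboolP; exact: regulatedM.
Qed.

Lemma rego_subring_closed : subring_closed rego_pred.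
Proof.
split.
- apply/asboolP; split; first exact: regulated_cst.
  by rewrite discontinuities_cst; exact: finite_set0.
- move=> f g /asboolP[rf ff] /asboolP[rg fg]; apply/asboolP.
  split; first exact: regulatedB.
  by apply: sub_finite_set (discontinuitiesB (g := g)) _; rewrite finite_setU.
- move=> f g /asboolP[rf ff] /asboolP[rg fg]; apply/asboolP.
  split; first exact: regulatedM.
  by apply: sub_finite_set (discontinuitiesM (g := g)) _; rewrite finite_setU.
Qed.

HB.instance Definition _ :=
  GRing.isSubringClosed.Build _ reg_pred reg_subring_closed.
HB.instance Definition _ :=
  GRing.isSubringClosed.Build _ rego_pred rego_subring_closed.

Record Reg : Type := MkReg {
  reg_fun :> unit_itv R -> R;
  _ : reg_fun \in reg_pred }.

HB.instance Definition _ := [isSub for reg_fun].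
HB.instance Definition _ := [Choice of Reg by <:].
HB.instance Definition _ := GRing.SubChoice_isSubComPzRing.Build _ _ Reg
  (subringClosedP _).

Record Rego : Type := MkRego {
  rego_fun :> unit_itv R -> R;
  _ : rego_fun \in rego_pred }.

HB.instance Definition _ := [isSub for rego_fun].
HB.instance Definition _ := [Choice of Rego by <:].
HB.instance Definition _ := GRing.SubChoice_isSubComPzRing.Build _ _ Rego
  (subringClosedP _).

Let zero_in_unit_itv : 0 \in (`[0, 1]%classic : set R).
Proof. by rewrite inE /= in_itv /= lexx ler01. Qed.

Let unit_itv0 : unit_itv R := exist _ 0 zero_in_unit_itv.

Lemma reg_oner_neq0 : (1 : Reg) != 0.
Proof.
apply/eqP => /(congr1 (fun f : Reg => f unit_itv0)) /eqP.
exact/negP/oner_neq0.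
Qed.

Lemma rego_oner_neq0 : (1 : Rego) != 0.
Proof.
apply/eqP => /(congr1 (fun f : Rego => f unit_itv0)) /eqP.
exact/negP/oner_neq0.
Qed.

HB.instance Definition _ := GRing.PzSemiRing_isNonZero.Build Reg reg_oner_neq0.
HB.instance Definition _ :=
  GRing.PzSemiRing_isNonZero.Build Rego rego_oner_neq0.
HB.instance Definition _ := GRing.ComPzRing.on Reg.
HB.instance Definition _ := GRing.ComPzRing.on Rego.

End Regulated.

(** * Prime spectrum and maximal ideals *)

(* All the fields of a [prime_idealr A] besides the underlying predicate are
   propositions, so that its elements are the prime ideals of A
   (see [Spec_ext]). *)
Definition Spec (A : comNzRingType) : Type := prime_idealr A.

Section Spec.
Variable A : comNzRingType.

HB.instance Definition _ := gen_eqMixin (Spec A).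
HB.instance Definition _ := gen_choiceMixin (Spec A).

Definition spec_mem (P : Spec A) : {pred A} := P : prime_idealr A.

Lemma Spec_ext (P Q : Spec A) : spec_mem P =i spec_mem Q -> P = Q.
Proof.
case: P Q => [S [[s1] [s2] [s3] [s4]]] [T [[t1] [t2] [t3] [t4]]] /= eST.
have e : S = T by apply/funext => x; exact: eST.
case: _ / e in t1 t2 t3 t4 eST *.
by rewrite (Prop_irrelevance s1 t1) (Prop_irrelevance s2 t2)
  (Prop_irrelevance s3 t3) (Prop_irrelevance s4 t4).
Qed.

Definition basic_open (a : A) : set (Spec A) :=
  [set P | a \notin spec_mem P].

(* Zariski topology, generated by the basic open sets D(a). *)
HB.instance Definition _ :=
  @isSubBaseTopological.Build (Spec A) (set (Spec A)) (range basic_open) id.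

Definition Specm : set (Spec A) :=
  [set P | forall Q : idealr A,
     {subset spec_mem P <= (Q : {pred A})} -> spec_mem P =i (Q : {pred A})].

End Spec.

Arguments Specm : clear implicits.

(** * Real spectrum *)

Section Sper.
Variable A : comNzRingType.

Definition cone_support (C : {pred A}) : {pred A} :=
  fun a => (a \in C) && (- a \in C).

(* The points of the real spectrum are the prime cones: C is the set of
   elements that are >= 0 for a total ordering of the residue field of the
   prime ideal [cone_support C]. *)
Definition prime_cone (C : {pred A}) : Prop :=
  [/\ {in C &, forall a b, a + b \in C},
      {in C &, forall a b, a * b \in C},
      (forall a, (a \in C) || (- a \in C)),
      idealr_closed (cone_support C)
    & prime_idealr_closed (cone_support C)].

Record Sper : Type := MkSper {
  cone :> {pred A};
  coneP : prime_cone cone }.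

HB.instance Definition _ := gen_eqMixin Sper.
HB.instance Definition _ := gen_choiceMixin Sper.

(* The orderings for which a > 0. *)
Definition positive_locus (a : A) : set Sper :=
  [set C | - a \notin cone C].

(* Spectral (Harrison) topology, generated by the sets {a > 0}. *)
HB.instance Definition _ :=
  @isSubBaseTopological.Build Sper (set Sper) (range positive_locus) id.

Definition Sperm : set Sper := [set C | closed [set C]].

End Sper.

Arguments Sperm : clear implicits.

(** * Residue domains A/p *)

Definition residue (A : comNzRingType) (P : Spec A) : Type :=
  {ideal_quot (P : prime_idealr A)}.

Section Residue.
Variables (A : comNzRingType) (P : Spec A).

HB.instance Definition _ :=
  GRing.ComNzRing.copy (residue P) {ideal_quot (P : prime_idealr A)}.

(* [idomainType] asks for a unit predicate and an inverse, total by the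
   convention x^-1 = x on non-units; they exist classically. *)
Let unit : {pred residue P} := fun x => `[< exists y, y * x = 1 >].

Let inv (x : residue P) : residue P :=
  if pselect (exists y, y * x = 1) is left e then projT1 (cid e) else x.

Let mulVx : {in unit, left_inverse 1 inv *%R}.
Proof. by move=> x /asboolP e; rewrite /inv; case: pselect => // e'; case: cid. Qed.

Let unitPl (x y : residue P) : y * x = 1 -> x \in unit.
Proof. by move=> e; apply/asboolP; exists y. Qed.

Let invr_out : {in [predC unit], inv =1 id}.
Proof. by move=> x /asboolPn ne; rewrite /inv; case: pselect. Qed.

HB.instance Definition _ :=
  GRing.ComNzRing_hasMulInverse.Build (residue P) mulVx unitPl invr_out.

HB.instance Definition _ :=
  GRing.ComUnitRing_isIntegral.Build (residue P)
    (@Quotient.rquot_IdomainAxiom A P).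

End Residue.

(** * Real closed rings *)

Definition integrally_closed (D : idomainType) : Prop :=
  forall x : {fraction D},
    integralOver (@FracField.tofrac D) x -> exists d : D, x = FracField.tofrac d.

(* F is the underlying field of some (ordered) real closed field. *)
Definition real_closed_field (F : fieldType) : Prop :=
  exists (K : rcfType) (f : {rmorphism F -> K}), bijective f.

Section RealClosedRing.
Variable A : comNzRingType.
Implicit Types (le : A -> A -> Prop) (a b c x y z m : A).

Definition partial_order le : Prop :=
  [/\ forall x, le x x,
      forall x y, le x y -> le y x -> x = y
    & forall x y z, le x y -> le y z -> le x z].

Definition is_inf le x y m : Prop :=
  [/\ le m x, le m y & forall z, le z x -> le z y -> le z m].

Definition is_sup le x y m : Prop :=
  [/\ le x m, le y m & forall z, le x z -> le y z -> le m z].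

Definition f_ring le : Prop :=
  [/\ partial_order le,
      forall x y, (exists m, is_inf le x y m) /\ (exists m, is_sup le x y m),
      forall x y z, le x y -> le (x + z) (y + z),
      forall x y, le 0 x -> le 0 y -> le 0 (x * y)
    & forall a b c, is_inf le a b 0 -> le 0 c -> is_inf le (c * a) b 0].

Definition real_closed_ring : Prop :=
  exists le,
    [/\ f_ring le,
        forall a, le 0 a <-> exists b, a = b ^+ 2,
        forall a b, le 0 a -> le a b -> exists c, a ^+ 2 = b * c
      & forall P : Spec A, integrally_closed (residue P) /\
                           real_closed_field {fraction (residue P)}].

End RealClosedRing.

Definition homeomorphic (X Y : topologicalType) : Prop :=
  exists (f : X -> Y) (g : Y -> X),
    [/\ continuous f, continuous g, cancel f g & cancel g f].

(* Main.v *)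
From HB Require Import structures.
Require Import Defs.
From mathcomp Require Import all_boot all_order all_algebra.
From mathcomp Require Import all_classical all_reals all_analysis.
From mathcomp Require Import polyrcf.
From mathcomp Require Import lra zify.
Import Order.TTheory GRing.Theory Num.Theory.
Import numFieldNormedType.Exports.

(** Why the theorem holds.

    Both rings are stable under superposition: if Phi is compatible with
    limits, then the one-sided limits of Phi (f_1, ..., f_n) are the values
    of Phi at the one-sided limits of the f_i, and a point where all the f_i
    are continuous is a point of continuity of the result.  The theorem
    follows from this stability ([limit_stable]), for any ring of real
    functions separated by its evaluations.

    Superposition with square roots and with a^2 / b (continuous where
    0 <= a <= b, since it is then at most b) gives the f-ring structure, the
    divisibility of a^2 by b, and three identities collected in
    [square_closed]: a = u^2 - v^2 with u v = 0, a^2 + b^2 = c^2, and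
    a^4 = c (a^2 + b^2).  Modulo a prime P, the first makes every element or
    its opposite a square, the other two make the squares the nonnegative
    cone of a total order.  A prime cone with support P must contain the
    squares, so it is the set of elements that become squares modulo P:
    prime cones and prime ideals determine each other, and the two topologies
    agree ([Sper_homeomorphic_Spec]).  Under this correspondence a cone is
    closed iff its support is maximal, because the radical of a proper ideal
    that contains a prime ideal is itself prime ([radical_prime]).

    Real closedness of the residue fields requires roots of a monic
    polynomial whose coefficients vary with the point x of [0,1].  A real
    root cannot be followed continuously, since it may disappear; virtual
    roots can.  They are defined by induction on the degree: the virtual
    roots of p' and a bound +-M cut the line into intervals on which p is
    strictly monotone, and the virtual root of p in such an interval is the
    point where |p| is least.  They depend continuously on the coefficients
    ([cvg_vroots]), so they lie in the ring when the coefficients do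
    ([vroots_pt]), and every real root is a virtual root ([vrootsP]).

    The intermediate value property modulo P: if q(a) q(b) <= 0 at a point x,
    some virtual root of q clamped to [a, b] is a root of q at x.  Hence a
    product of values of q at elements between a and b, times a factor that
    vanishes where the sign condition fails, is zero, and one of the factors
    is zero in the domain A/P ([residue_monic_ivt]).  Clearing denominators,
    the fraction field is real closed ([frac_ivt]).  For integral
    closedness, the inequalities that define virtual roots are weak, so they
    survive reduction modulo P; in the real closed field Frac(A/P) they again
    force every root of a monic q to be the class of a virtual root, which
    lies in A/P ([vroots_cover]). *)

Set Implicit Arguments.
Unset Strict Implicit.
Unset Printing Implicit Defensive.

Local Open Scope classical_set_scope.
Local Open Scope ring_scope.

(** * Virtual roots over a real closed field *)

Section Endpoints.
Variable A : comNzRingType.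
Implicit Types (p : {poly A}) (s : seq A).

(** A Cauchy bound for the roots of p that also dominates the entries of s.
    The terms 1 + x^2 stand for |x|, so that the bound makes sense in every
    commutative ring and commutes with morphisms. *)
Definition root_bound n p s : A :=
  1 + \sum_(i < n.+1) (1 + p`_i ^+ 2) + \sum_(c <- s) (1 + c ^+ 2).

Definition endpoints n p s : seq A :=
  - root_bound n p s :: rcons s (root_bound n p s).

Lemma size_endpoints n p s : size (endpoints n p s) = (size s).+2.
Proof. by rewrite /= size_rcons. Qed.

(** Degree n with leading coefficient k+1.  Unlike monic polynomials, these
    are stable under derivation; the positive integer leading coefficient
    keeps its meaning under every morphism, and is at least 1 in an ordered
    field, as the bound on the roots requires. *)
Definition nat_lead n k p : Prop := (size p <= n.+1)%N /\ p`_n = k.+1%:R.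

Lemma nat_lead_deriv n k p : nat_lead n.+1 k p -> exists k', nat_lead n k' p^`().
Proof.
move=> [sp lp]; exists (k.+1 * n.+1).-1; split.
  have [->|p0] := eqVneq p 0; first by rewrite deriv0 size_poly0.
  by have := lt_size_deriv p0; lia.
by rewrite coef_deriv lp prednK // natrM mulr_natr.
Qed.

End Endpoints.

Section VirtualRoots.
Variable K : rcfType.
Implicit Types (p : {poly K}) (s rho : seq K).

(** When p is monotone on [a, b], r is the point of [a, b] where |p| is
    least: the last two inequalities say that, unless p vanishes at r, the
    values of p at a and b have the sign of p(r) and are at least as large in
    absolute value.  Being weak polynomial inequalities, these conditions
    pass to limits and to ordered quotients. *)
Definition virtual_root p (a b r : K) : Prop :=
  [/\ a <= r, r <= b, p.[r] ^+ 2 <= p.[r] * p.[a]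
    & p.[r] ^+ 2 <= p.[r] * p.[b]].

Lemma root_virtual_root p a b r : a <= r <= b -> root p r -> virtual_root p a b r.
Proof. by move=> /andP[ar rb] /rootP pr; split; rewrite // pr expr0n mul0r. Qed.

Lemma virtual_rootN p a b r : virtual_root p a b r -> virtual_root (- p) a b r.
Proof. by move=> [? ? ? ?]; split; rewrite // !hornerN mulrNN sqrrN. Qed.

Lemma virtual_root_ex p a b : a <= b -> exists r, virtual_root p a b r.
Proof.
move=> ab; have [pab|pab] := leP (p.[a] * p.[b]) 0.
  have [r rab pr] := polyrcf.poly_ivt ab pab; exists r.
  by apply: root_virtual_root pr; rewrite in_itv in rab.
have [le_ab|le_ba] := leP (p.[a] ^+ 2) (p.[a] * p.[b]).
  by exists a; split; rewrite // expr2.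
exists b; split; rewrite // ?expr2 //.
by move: pab le_ba; rewrite !expr2; nra.
Qed.

(** By Rolle's theorem p takes distinct values at distinct points of [a, b].
    If r < r' are both virtual roots with, say, p(r) < p(r'), then either
    p(r') > 0, and p(a) >= p(r') forces p to take the value p(r') again on
    [a, r], or p(r) < 0, and p(b) <= p(r) forces p to take the value p(r)
    again on [r', b]. *)
Lemma virtual_root_uniq p a b r r' :
  (forall x, a < x < b -> ~~ root p^`() x) ->
  virtual_root p a b r -> virtual_root p a b r' -> r = r'.
Proof.
wlog lt_r : r r' / r < r'.
  move=> H p' c c'; case: (ltgtP r r') => [lt_r|lt_r|//]; first exact: H.
  by apply/esym; exact: H.
have no_rolle q u v : (forall x, a < x < b -> ~~ root q^`() x) ->
    a <= u -> u < v -> v <= b -> q.[u] <> q.[v].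
  move=> q' au uv vb quv; have [c cuv /rootP qc] := rolle uv quv.
  move: cuv; rewrite in_itv => /andP[uc cv].
  by have := q' c; rewrite qc (le_lt_trans au uc) (lt_le_trans cv vb) => /(_ isT).
wlog lt_p : p / p.[r] < p.[r'].
  move=> H p' c c'; case: (ltgtP p.[r] p.[r']) => [lt_p|lt_p|e].
  - exact: (H p).
  - apply: (H (- p)); rewrite ?hornerN ?ltrN2 //; [|exact: virtual_rootN..].
    by move=> x /p'; rewrite derivN rootN.
  - by case: c c' => ar _ _ _ [_ rb _ _]; case: (no_rolle p r r').
move=> p' [ar rb par pbr] [ar' rb' par' pbr'].
have [v_gt0|v_le0] := ltP 0 p.[r'].
- have ge_pa : p.[r'] <= p.[a] by rewrite -(ler_pM2l v_gt0) -expr2.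
  have [|y] := @polyrcf.poly_ivt K (p - p.[r']%:P) a r ar.
    rewrite !hornerD !hornerN !hornerC mulr_ge0_le0 ?subr_ge0 //.
    by rewrite subr_le0 ltW.
  rewrite in_itv rootE !hornerD !hornerN !hornerC subr_eq0 => /andP[ay yr] /eqP.
  by move=> /no_rolle; case; rewrite // (le_lt_trans yr).
- have u_lt0 : p.[r] < 0 by apply: lt_le_trans v_le0.
  have le_pb : p.[b] <= p.[r] by rewrite -(ler_nM2l u_lt0) -expr2.
  have [|y] := @polyrcf.poly_ivt K (p - p.[r]%:P) r' b rb'.
    rewrite !hornerD !hornerN !hornerC mulr_ge0_le0 ?subr_le0 //.
    by rewrite subr_ge0 ltW.
  rewrite in_itv rootE !hornerD !hornerN !hornerC subr_eq0 => /andP[ry yb] /eqP e.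
  by have /no_rolle := esym e; case; rewrite // (lt_le_trans lt_r).
Qed.

Lemma sum_norm_le_sqr (I : Type) (l : seq I) (F : I -> K) :
  \sum_(i <- l) `|F i| <= \sum_(i <- l) (1 + F i ^+ 2).
Proof.
apply: ler_sum => i _; rewrite -real_normK ?num_real //.
by have := sqr_ge0 (`|F i| - 1); rewrite sqrrB1; have := sqr_ge0 `|F i|; lra.
Qed.

Lemma le_root_bound n p s c : c \in s -> `|c| <= root_bound n p s.
Proof.
move=> cs; apply: le_trans (_ : \sum_(c <- s) (1 + c ^+ 2) <= _).
  apply: le_trans (sum_norm_le_sqr _ _).
  by rewrite (big_rem c) //= lerDl sumr_ge0.
by rewrite lerDr addr_ge0 // sumr_ge0 // => i _; rewrite addr_ge0 ?sqr_ge0.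
Qed.

Lemma root_le_bound n k p s x :
  nat_lead n k p -> root p x -> `|x| <= root_bound n p s.
Proof.
move=> [sp lp] /rootP px.
have p0 : p != 0 by apply: contra_eq_neq lp => ->; rewrite coef0 eq_sym pnatr_eq0.
have sp' : size p = n.+1.
  apply/eqP; rewrite eqn_leq sp /= ltnNge; apply/negP => /(leq_sizeP _ _)/(_ n (leqnn n)).
  by rewrite lp => /eqP; rewrite pnatr_eq0.
apply: (le_trans (ltW (cauchy_boundP p0 px))).
rewrite /cauchy_bound /root_bound -addrA lerD2l.
rewrite [lead_coef p]lead_coefE sp' /= lp normr_nat.
apply: le_trans (_ : \sum_(i < n.+1) `|p`_i| <= _).
  rewrite ler_piMl ?sumr_ge0 // invf_le1 ?ltr0Sn // ler1n //.
apply: (le_trans (sum_norm_le_sqr _ (fun i : 'I_n.+1 => p`_i))).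
by rewrite lerDl sumr_ge0 // => i _; rewrite addr_ge0 ?sqr_ge0.
Qed.

Lemma endpoints_sorted n p s : sorted <=%R s -> sorted <=%R (endpoints n p s).
Proof.
move=> ss; set b := root_bound n p s.
have sb c : c \in s -> - b <= c <= b by move=> /(le_root_bound n p); rewrite ler_norml.
have b0 : 0 <= b.
  by rewrite !addr_ge0 // sumr_ge0 // => i _; rewrite addr_ge0 ?sqr_ge0.
rewrite /= rcons_path path_sortedE; last exact: le_trans.
rewrite ss andbT; apply/andP; split; first by apply/allP => c /sb /andP[].
have := mem_last (- b) s; rewrite inE => /orP[/eqP -> | /sb /andP[] //].
by rewrite ge0_cp.
Qed.

Lemma sorted_cover (e : seq K) x : (1 < size e)%N ->
  e`_0 <= x <= last 0 e -> exists2 i, (i.+1 < size e)%N & e`_i <= x <= e`_i.+1.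
Proof.
elim: e => [|a [|b e] IH] //= _ /andP[ax xe].
have [xb|/ltW bx] := leP x b; first by exists 0%N; rewrite //= ax.
case: e IH xe => [_ xb|c e IH xe] /=; first by exists 0%N; rewrite //= ax.
by have [|i i_lt i_x] := IH isT; [rewrite /= bx | exists i.+1].
Qed.

(** Meant for s the list of virtual roots of p', so that p is monotone between
    consecutive endpoints. *)
Definition interlace n p s rho :=
  forall i, (i <= n)%N -> virtual_root p (endpoints n.+1 p s)`_i
    (endpoints n.+1 p s)`_i.+1 rho`_i.

Lemma endpoints_gap n p s i : sorted <=%R s -> (i <= size s)%N ->
  (forall x, root p^`() x -> x \in s) ->
  forall x, (endpoints n p s)`_i < x < (endpoints n p s)`_i.+1 -> ~~ root p^`() x.
Proof.
move=> ss le_i p's x /andP[ix xi]; apply/negP => /p's xs.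
set e := endpoints n p s in ix xi.
have /nthP : x \in e by rewrite inE mem_rcons inE xs !orbT.
move=> /(_ 0)[j j_lt xj]; rewrite -xj in ix xi.
have es : sorted <=%R e by exact: endpoints_sorted.
have size_e : size e = (size s).+2 by exact: size_endpoints.
rewrite size_e in j_lt; have le_e := le_sorted_leq_nth 0 es.
have [le_ji|lt_ij] := leqP j i.
  by have := le_e _ _ _ _ le_ji; rewrite !inE size_e leNgt ix; lia.
by have := le_e _ _ _ _ lt_ij; rewrite !inE size_e leNgt xi; lia.
Qed.

(** A root of p lies between two consecutive endpoints, hence is a virtual
    root there, and uniqueness applies. *)
Lemma interlace_roots n k p s rho :
  nat_lead n.+1 k p -> sorted <=%R s -> size s = n -> size rho = n.+1 ->
  (forall x, root p^`() x -> x \in s) -> interlace n p s rho ->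
  sorted <=%R rho /\ forall x, root p x -> x \in rho.
Proof.
move=> np ss size_s size_rho p's inter; split.
  apply/(sortedP 0) => i; rewrite size_rho ltnS => lt_i.
  have [_ le1 _ _] := inter _ (ltnW lt_i); have [le2 _ _ _] := inter _ lt_i.
  exact: le_trans le1 le2.
move=> x px; set e := endpoints n.+1 p s.
have size_e : size e = n.+2 by rewrite size_endpoints size_s.
have xe : e`_0 <= x <= last 0 e.
  by rewrite /= last_rcons -ler_norml; exact: (root_le_bound s np px).
have e_gt1 : (1 < size e)%N by rewrite size_e.
have [i lt_i xi] := sorted_cover e_gt1 xe.
rewrite size_e !ltnS in lt_i.
have -> : x = rho`_i.
  apply: virtual_root_uniq (inter _ lt_i); last exact: root_virtual_root.
  by apply: endpoints_gap; rewrite ?size_s.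
by rewrite mem_nth // size_rho.
Qed.

End VirtualRoots.

(** * Continuity of the virtual roots of real polynomials *)

Section Ultra.

(** If f fails to send F into a neighbourhood V of l, then F together with the
    complement of the preimage of V is contained in an ultrafilter along which f
    cannot converge to l. *)
Lemma cvg_ultra (T : Type) (U : topologicalType) (F : set_system T)
    (f : T -> U) (l : U) : ProperFilter F ->
  (forall G, UltraFilter G -> F `<=` G -> f @ G --> l) -> f @ F --> l.
Proof.
move=> FF H V lV; apply: contrapT => nFV.
pose W := within (~` (f @^-1` V)) F.
have PW : ProperFilter W.
  apply: Build_ProperFilter => //.
  move=> W0; apply: nFV; apply: (@filterS _ F _ _ _ _ W0) => x /= nx.
  exact: contrapT nx.
have [G [GU FG]] := ultraFilterLemma PW.
have GV : G (f @^-1` V).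
  by apply: (H G GU) lV => A FA; apply: FG; apply: (@filterS _ F _ _ _ _ FA) => x.
have GnV : G (~` (f @^-1` V)) by apply: FG; apply: (@filterE _ F).
have : G set0 by apply: filterS (filterI GV GnV) => x [].
exact: filter_not_empty.
Qed.

Lemma ultra_bounded_cvg (R : realType) (T : Type) (G : set_system T)
    (f : T -> R) (b : R) : UltraFilter G ->
  (\forall t \near G, `|f t| <= b) -> exists x : R, f @ G --> x.
Proof.
move=> GU Gb.
have fG : (f @ G) `[- b, b]%classic.
  by apply: filterS Gb => t; rewrite /= in_itv /= ler_norml.
have [x [_ clx]] := segment_compact _ fG.
exists x => V xV; have [//|GnV] := in_ultra_setVsetC (f @^-1` V) GU.
by have [y []] := clx (~` V) V GnV xV.
Qed.

End Ultra.

Section RealVirtualRoots.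
Variable R : realType.
Implicit Types (p q : {poly R}).

Fixpoint vroots n p : seq R :=
  if n is m.+1 then
    let e := endpoints n p (vroots m p^`()) in
    mkseq (fun i => xget 0 [set r | virtual_root p e`_i e`_i.+1 r]) n
  else [::].

Lemma size_vroots n p : size (vroots n p) = n.
Proof. by case: n => // n; exact: size_mkseq. Qed.

Lemma vroots_interlace_aux n p : sorted <=%R (vroots n p^`()) ->
  interlace n p (vroots n p^`()) (vroots n.+1 p).
Proof.
move=> ss i le_i; rewrite [X in virtual_root _ _ _ X]nth_mkseq //.
apply: (@xgetPex _ 0 [set r | virtual_root p _ _ r]); apply: virtual_root_ex.
have /(sortedP 0) := endpoints_sorted n.+1 p ss; apply.
by rewrite size_endpoints size_vroots.
Qed.

(** Sortedness and covering go together: sortedness of the virtual roots of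
    p' is what makes the endpoints for p cut the line into intervals. *)
Lemma vrootsP n k p : nat_lead n k p ->
  sorted <=%R (vroots n p) /\ forall x, root p x -> x \in vroots n p.
Proof.
elim: n k p => [|n IH] k p np.
  have [sp lp] := np; split=> // x; rewrite (size1_polyC sp) lp rootC.
  by rewrite pnatr_eq0.
have [k' np'] := nat_lead_deriv np; have [ss p's] := IH _ _ np'.
by apply: interlace_roots np ss _ _ p's (vroots_interlace_aux ss);
  rewrite size_vroots.
Qed.

Lemma vroots_interlace n k p : nat_lead n.+1 k p ->
  interlace n p (vroots n p^`()) (vroots n.+1 p).
Proof.
by move=> /nat_lead_deriv[k' /vrootsP[ss _]]; exact: vroots_interlace_aux.
Qed.

Section Continuity.
Variables (T : topologicalType) (F : set_system T).
Context {FF : ProperFilter F}.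

Lemma cvg_pow (f : T -> R) (a : R) n : f @ F --> a -> (f t ^+ n) @[t --> F] --> a ^+ n.
Proof.
move=> fa; elim: n => [|n IH]; first by under eq_fun do rewrite expr0; exact: cvg_cst.
by under eq_fun do rewrite exprS; rewrite exprS; apply: cvgM.
Qed.

Lemma cvg_horner n (p : T -> {poly R}) q (f : T -> R) (a : R) :
  (forall t, size (p t) <= n)%N -> (size q <= n)%N ->
  (forall i, (p t)`_i @[t --> F] --> q`_i) -> f @ F --> a ->
  (p t).[f t] @[t --> F] --> q.[a].
Proof.
move=> sp sq pq fa; under eq_fun do rewrite (horner_coef_wide _ (sp _)).
rewrite (horner_coef_wide _ sq); apply: cvg_big => [|i _]; first exact: add_continuous.
by apply: cvgM => //; exact: cvg_pow.
Qed.

Lemma cvg_endpoints m n (p : T -> {poly R}) q (s : T -> seq R) (s0 : seq R) :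
  (forall t, size (s t) = n)%N -> (size s0 = n)%N ->
  (forall i, (p t)`_i @[t --> F] --> q`_i) ->
  (forall i, (s t)`_i @[t --> F] --> s0`_i) ->
  forall i, (endpoints m (p t) (s t))`_i @[t --> F] --> (endpoints m q s0)`_i.
Proof.
move=> size_s size_s0 pq ss0.
have cb : root_bound m (p t) (s t) @[t --> F] --> root_bound m q s0.
  have E (u : seq R) : size u = n -> forall p, root_bound m p u =
      1 + \sum_(i < m.+1) (1 + p`_i ^+ 2) + \sum_(i < n) (1 + u`_i ^+ 2).
    by move=> <- p'; rewrite /root_bound [\sum_(c <- u) _](big_nth 0) big_mkord.
  under eq_fun do rewrite (E _ (size_s _)).
  rewrite (E _ size_s0); apply: cvgD; first apply: cvgD; first exact: cvg_cst.
    apply: cvg_big => [|i _]; first exact: add_continuous.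
    by apply: cvgD; [exact: cvg_cst | exact: cvg_pow].
  apply: cvg_big => [|i _]; first exact: add_continuous.
  by apply: cvgD; [exact: cvg_cst | exact: cvg_pow].
case=> [|i] /=; first exact: cvgN.
under eq_fun do rewrite nth_rcons size_s.
by rewrite nth_rcons size_s0; case: ltngtP => _ //; [exact: ss0 | exact: cvg_cst].
Qed.

End Continuity.

(** Along an ultrafilter the virtual root converges, being trapped between
    convergent endpoints; its limit still satisfies the weak inequalities
    that characterize the virtual root of the limit polynomial. *)
Lemma cvg_vroots n (T : topologicalType) (F : set_system T) (p : T -> {poly R}) q :
  ProperFilter F -> (forall t, exists k, nat_lead n k (p t)) ->
  (exists k, nat_lead n k q) -> (forall i, (p t)`_i @[t --> F] --> q`_i) ->
  forall i, (vroots n (p t))`_i @[t --> F] --> (vroots n q)`_i.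
Proof.
elim: n p q => [|n IH] p q FF np nq pq i.
  by under eq_fun do rewrite nth_nil; rewrite nth_nil; exact: cvg_cst.
have [lt_i|gt_i] := leqP i n; last first.
  under eq_fun do rewrite nth_default ?size_vroots //.
  by rewrite nth_default ?size_vroots //; exact: cvg_cst.
have [k nqk] := nq; have [k' nqk'] := nat_lead_deriv nqk.
pose s t := vroots n (p t)^`(); pose s0 := vroots n q^`().
have ss0 j : (s t)`_j @[t --> F] --> s0`_j.
  apply: IH => [t||{}j].
  - by have [kt /nat_lead_deriv] := np t.
  - by exists k'.
  - rewrite (_ : (fun t => (p t)^`()`_j) = (fun t => (p t)`_j.+1 * j.+1%:R)).
      rewrite coef_deriv -[q`_j.+1 *+ _]mulr_natr.
      by apply: cvgM; [exact: pq | exact: cvg_cst].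
    by apply/funext => t; rewrite coef_deriv mulr_natr.
have cvg_e j : (endpoints n.+1 (p t) (s t))`_j @[t --> F] --> (endpoints n.+1 q s0)`_j.
  by apply: cvg_endpoints => //; rewrite ?size_vroots // => t; rewrite size_vroots.
have vp t : virtual_root (p t) (endpoints n.+1 (p t) (s t))`_i
    (endpoints n.+1 (p t) (s t))`_i.+1 (vroots n.+1 (p t))`_i.
  by have [kt /vroots_interlace] := np t; exact.
apply: cvg_ultra => G GU FG.
have toG (f : T -> R) (l : R) : f @ F --> l -> f @ G --> l.
  by move=> + V lV => /(_ V lV); exact: FG.
have [w cw] : exists w : R, (vroots n.+1 (p t))`_i @[t --> G] --> w.
  have near_e j := cvgr_norm_lt _ (toG _ _ (cvg_e j)).
  set b0 := `|(endpoints n.+1 q s0)`_i|; set b1 := `|(endpoints n.+1 q s0)`_i.+1|.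
  apply: (ultra_bounded_cvg (b := (b0 + 1) + (b1 + 1))).
  have lt_b (b : R) : b < b + 1 by rewrite ltrDl.
  near=> t; have [] := vp t.
  have : `|(endpoints n.+1 (p t) (s t))`_i| < b0 + 1.
    by near: t; exact: near_e.
  have : `|(endpoints n.+1 (p t) (s t))`_i.+1| < b1 + 1.
    by near: t; exact: near_e.
  rewrite !ltr_norml ler_norml => /andP[? ?] /andP[? ?] ? ? _ _.
  by apply/andP; split; lra.
suff <- : w = (vroots n.+1 q)`_i by [].
apply: virtual_root_uniq (vroots_interlace nqk lt_i).
  apply: endpoints_gap; rewrite ?size_vroots //.
  - by have [] := vrootsP nqk'.
  - by have [] := vrootsP nqk'.
have sp t : (size (p t) <= n.+2)%N by have [? []] := np t.
have cp (f : T -> R) (l : R) : f @ G --> l -> (p t).[f t] @[t --> G] --> q.[l].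
  by apply: cvg_horner; [exact: sp | case: nqk |move=> j; exact: toG].
have cM j : (p t).[(vroots n.+1 (p t))`_i] * (p t).[(endpoints n.+1 (p t) (s t))`_j]
    @[t --> G] --> q.[w] * q.[(endpoints n.+1 q s0)`_j].
  by apply: cvgM; [exact: cp | exact: cp (toG _ _ (cvg_e j))].
split.
- by apply: (ler_cvg_to (toG _ _ (cvg_e i)) cw); apply: nearW => t; have [] := vp t.
- by apply: (ler_cvg_to cw (toG _ _ (cvg_e i.+1))); apply: nearW => t; have [] := vp t.
- by apply: (ler_cvg_to (cvg_pow (cp _ _ cw)) (cM i)); apply: nearW => t; have [] := vp t.
- by apply: (ler_cvg_to (cvg_pow (cp _ _ cw)) (cM i.+1)); apply: nearW => t; have [] := vp t.
Unshelve. all: by end_near.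
Qed.

End RealVirtualRoots.

(** * Topologies generated by a subbase *)

Section Subbase.
Variables (S : topologicalType) (B : set (set S)).
Hypothesis openS :
  @open S = [set \bigcup_(i in D') i | D' in subset^~ (finI_from B id)].

Lemma subbase_open b : B b -> open b.
Proof.
move=> Bb; rewrite openS; exists [set b]; last by rewrite bigcup_set1.
by move=> _ ->; exact: finI_from1.
Qed.

(** The sets that contain y as soon as they contain x are closed under finite
    intersections and unions. *)
Lemma subbase_open_spec (U : set S) x y : open U -> U x ->
  (forall b, B b -> b x -> b y) -> U y.
Proof.
rewrite openS => - [D sD <-] [V DV Vx] Bxy; exists V => //.
have [E sE EV] := sD _ DV; rewrite -EV in Vx *.
by move=> b Eb; apply: Bxy (Vx b Eb); have := sE b Eb; rewrite inE.
Qed.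

Lemma subbase_continuous (X : topologicalType) (f : X -> S) :
  (forall b, B b -> open (f @^-1` b)) -> continuous f.
Proof.
move=> fB x V; rewrite nbhsE => - [U [openU Ux] sUV].
move: openU Ux; rewrite openS => - [D sD DU]; rewrite -DU => - [W DW Wx].
have [E sE EW] := sD _ DW.
suff : nbhs x (f @^-1` W).
  by apply: filterS => z Wz; apply: sUV; rewrite -DU; exists W.
rewrite -EW in Wx *.
rewrite preimage_bigcap; apply: filter_bigI => b Eb.
apply: open_nbhs_nbhs; split; last exact: Wx.
by apply: fB; have := sE b Eb; rewrite inE.
Qed.

End Subbase.

(** * Prime ideals and residue domains *)

Section SpecOf.
Variable A : comNzRingType.

Definition spec_of (S : A -> bool) (idS : idealr_closed S)
    (prS : prime_idealr_closed S) : Spec A :=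
  HB.pack_for (prime_idealr A) S (isIdealr.Build A S idS)
   (isPrimeIdealrClosed.Build A S prS).

Variable P : Spec A.
Local Notation "a \inP" := (a \in spec_mem P) (at level 70).

Lemma spec_memM a b : (a * b \inP) = (a \inP) || (b \inP).
Proof. exact: prime_idealrM. Qed.

Lemma spec_memX a n : a ^+ n.+1 \inP = (a \inP).
Proof. by elim: n => [|n IH]; rewrite ?expr1 // exprS spec_memM IH orbb. Qed.

Definition quo : A -> residue P := (\pi_(residue P))%qT.

Lemma quo_is_zmod_morphism : zmod_morphism quo.
Proof. exact: pi_is_zmod_morphism. Qed.

Lemma quo_is_monoid_morphism : monoid_morphism quo.
Proof. exact: pi_is_monoid_morphism. Qed.

HB.instance Definition _ :=
  GRing.isZmodMorphism.Build A (residue P) quo quo_is_zmod_morphism.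
HB.instance Definition _ :=
  GRing.isMonoidMorphism.Build A (residue P) quo quo_is_monoid_morphism.

Lemma quo_eq0 a : (quo a == 0) = (a \inP).
Proof.
by rewrite -[a in RHS]subr0 /spec_mem Quotient.idealrBE -(rmorph0 quo).
Qed.

Lemma quo_surj (d : residue P) : exists a, d = quo a.
Proof. by exists (repr d); rewrite /quo generic_quotient.reprK. Qed.

End SpecOf.

(** * Rings with many squares and their real spectrum *)

Section SquareClosed.

(** The algebraic shadow of the presence of positive parts, square roots and
    bounded quotients: a is the difference of its positive and negative
    parts, written as orthogonal squares. *)
Definition square_closed (A : comNzRingType) : Prop :=
  [/\ forall a : A, exists u v, a = u ^+ 2 - v ^+ 2 /\ u * v = 0,
      forall a b : A, exists c, a ^+ 2 + b ^+ 2 = c ^+ 2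
    & forall a b : A, exists c, a ^+ 4 = c * (a ^+ 2 + b ^+ 2)].

Definition square (A : comNzRingType) (a : A) : Prop := exists b, a = b ^+ 2.

(** The squares are the nonnegative elements of a total order; the last
    clause is the antisymmetry of that order. *)
Definition square_ordered (D : idomainType) : Prop :=
  [/\ forall d : D, square d \/ square (- d),
      forall a b : D, square (a ^+ 2 + b ^+ 2)
    & forall a b : D, a ^+ 2 + b ^+ 2 = 0 -> a = 0].

Lemma squareM (A : comNzRingType) (a b : A) : square a -> square b -> square (a * b).
Proof. by move=> [u ->] [v ->]; exists (u * v); rewrite exprMn. Qed.

(** The factor of u v = 0 that vanishes modulo P decides the sign of
    u^2 - v^2, and a^4 = c (a^2 + b^2) makes P convex. *)
Lemma residue_ordered (A : comNzRingType) (P : Spec A) :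
  square_closed A -> square_ordered (residue P).
Proof.
move=> [dec sum conv]; split.
- move=> d; have [a ->] := quo_surj d; have [u [v [-> uv]]] := dec a.
  have /eqP := congr1 (quo P) uv; rewrite rmorphM rmorph0 mulf_eq0.
  case/orP => /eqP e; [right; exists (quo P v) | left; exists (quo P u)];
    by rewrite rmorphB !rmorphXn /= e expr0n /= ?sub0r ?subr0 ?opprK.
- move=> d d'; have [a ->] := quo_surj d; have [b ->] := quo_surj d'.
  have [c e] := sum a b; exists (quo P c).
  by rewrite -!rmorphXn -rmorphD e.
- move=> d d'; have [a ->] := quo_surj d; have [b ->] := quo_surj d'.
  have [c e] := conv a b => ab0; apply/eqP.
  have /eqP : quo P a ^+ 4 = 0.
    by rewrite -rmorphXn e rmorphM rmorphD !rmorphXn /= ab0 mulr0.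
  by rewrite expf_eq0.
Qed.

Variable A : comNzRingType.
Hypothesis sqA : square_closed A.

Definition supp (C : Sper A) : Spec A :=
  let: And5 _ _ _ idC prC := coneP C in spec_of idC prC.

Lemma suppE C a : (a \in spec_mem (supp C)) = (a \in cone C) && (- a \in cone C).
Proof. by rewrite /supp; case: (coneP C). Qed.

Lemma cone_sqr (C : Sper A) a : a ^+ 2 \in cone C.
Proof.
have [_ CM Ct _ _] := coneP C; have /orP[aC|aC] := Ct a.
  by rewrite expr2 CM.
by rewrite -sqrrN expr2 CM.
Qed.

(** If -a is congruent to t^2 modulo the support and a is in the cone, then
    -a = t^2 - (a + t^2) is in the cone too, so a vanishes in the residue
    domain and is a square there anyway. *)
Lemma coneE (C : Sper A) a : (a \in cone C) <-> square (quo (supp C) a).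
Proof.
have [CD CM Ct _ _] := coneP C; split.
  move=> aC; have [dec _ _] := residue_ordered (supp C) sqA.
  have [//|[d]] := dec (quo (supp C) a).
  have [t ->] := quo_surj d => e.
  have : a + t ^+ 2 \in spec_mem (supp C).
    by rewrite -quo_eq0 rmorphD rmorphXn /= -e subrr.
  rewrite suppE => /andP[_ naC].
  have : a \in spec_mem (supp C).
    rewrite suppE aC /= (_ : - a = - (a + t ^+ 2) + t ^+ 2); last by rewrite opprD subrK.
    by rewrite CD ?cone_sqr.
  by rewrite -quo_eq0 => /eqP ->; exists 0; rewrite expr0n.
move=> [d]; have [t ->] := quo_surj d => e.
have : a - t ^+ 2 \in spec_mem (supp C) by rewrite -quo_eq0 rmorphB rmorphXn /= e subrr.
by rewrite suppE => /andP[atC _]; rewrite -(subrK (t ^+ 2) a) CD ?cone_sqr.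
Qed.

Lemma supp_le_cone (C D : Sper A) : {subset cone C <= cone D} <->
  {subset spec_mem (supp C) <= spec_mem (supp D)}.
Proof.
split=> sCD a; first by rewrite !suppE => /andP[/sCD -> /sCD ->].
rewrite (coneE C) (coneE D) => -[d].
have [t ->] := quo_surj d => e; exists (quo (supp D) t).
apply/eqP; rewrite -subr_eq0 -rmorphXn -rmorphB quo_eq0; apply: sCD.
by rewrite -quo_eq0 rmorphB rmorphXn /= e subrr.
Qed.

Lemma Sper_ext (C D : Sper A) : cone C =i cone D -> C = D.
Proof.
case: C D => [C c] [D d] /= e.
have eCD : C = D by apply/funext => x; exact: e.
by case: _ / eCD in d e *; rewrite (Prop_irrelevance c d).
Qed.

Lemma supp_inj : injective supp.
Proof.
move=> C D e; apply: Sper_ext => a.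
have [CD DC] : {subset cone C <= cone D} /\ {subset cone D <= cone C}.
  by split; apply/supp_le_cone; rewrite e.
by apply/idP/idP; [exact: CD | exact: DC].
Qed.

Definition sqr_cone (P : Spec A) : {pred A} := fun a => `[< square (quo P a) >].

Lemma sqr_cone_support P : cone_support (sqr_cone P) = (spec_mem P : A -> bool).
Proof.
have [dec sum inj] := residue_ordered P sqA; apply/funext => a.
rewrite /cone_support -[RHS]quo_eq0; apply/andP/eqP.
  move=> [/asboolP[s es] /asboolP[t]]; rewrite rmorphN /= es => et.
  have s0 : s = 0 by apply: (inj s t); rewrite -et subrr.
  by rewrite s0 expr0n.
by move=> e; split; apply/asboolP; exists 0; rewrite ?rmorphN /= e ?oppr0 expr0n.
Qed.

Lemma sqr_cone_prime P : prime_cone (sqr_cone P).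
Proof.
have [dec sum inj] := residue_ordered P sqA; split.
- move=> a b /asboolP[s es] /asboolP[t et]; apply/asboolP.
  by rewrite rmorphD /= es et; exact: sum.
- move=> a b /asboolP sa /asboolP sb; apply/asboolP.
  by rewrite rmorphM; exact: squareM.
- move=> a; apply/orP; have [sa|sa] := dec (quo P a); [left|right]; apply/asboolP => //.
  by rewrite rmorphN.
- rewrite sqr_cone_support; split; first exact: idealr0.
    by rewrite /spec_mem idealr1.
  by move=> a u v uP vP; rewrite rpredD // idealMr.
- by rewrite sqr_cone_support => u v; rewrite [_ \in _](spec_memM P u v).
Qed.

Definition sqr_order (P : Spec A) : Sper A := MkSper (sqr_cone_prime P).

Lemma sqr_orderK : cancel sqr_order supp.
Proof.
by move=> P; apply: Spec_ext => a; rewrite suppE -(sqr_cone_support P).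
Qed.

Lemma suppK : cancel supp sqr_order.
Proof. by move=> C; apply: supp_inj; rewrite sqr_orderK. Qed.

Lemma Spec_open : @open (Spec A) =
  [set \bigcup_(i in D') i | D' in subset^~ (finI_from (range (@basic_open A)) id)].
Proof. by []. Qed.

Lemma Sper_open : @open (Sper A) =
  [set \bigcup_(i in D') i | D' in subset^~ (finI_from (range (@positive_locus A)) id)].
Proof. by []. Qed.

Lemma supp_continuous : continuous supp.
Proof.
apply: (subbase_continuous Spec_open) => _ [a _ <-].
rewrite (_ : _ @^-1` _ = positive_locus (a ^+ 2)).
  by apply: (subbase_open Sper_open); exists (a ^+ 2).
apply/seteqP; split=> C; rewrite /basic_open /positive_locus /=.
  by rewrite -(spec_memX _ _ 1) suppE cone_sqr.
by rewrite -(spec_memX _ _ 1) suppE cone_sqr.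
Qed.

Lemma sqr_order_continuous : continuous sqr_order.
Proof.
have [dec _ _] := sqA.
apply: (subbase_continuous Sper_open) => _ [a _ <-].
have [u [v [eq_a uv0]]] := dec a.
rewrite (_ : _ @^-1` _ = basic_open u).
  by apply: (subbase_open Spec_open); exists u.
apply/seteqP; split=> P; rewrite /basic_open /positive_locus /=.
  apply: contra; rewrite -quo_eq0 => /eqP u0; apply/asboolP; exists (quo P v).
  by rewrite eq_a opprB rmorphB !rmorphXn /= u0 expr0n subr0.
have [_ _ inj] := residue_ordered P sqA.
apply: contra => /asboolP[s es]; rewrite -quo_eq0; apply/eqP.
have /eqP := congr1 (quo P) uv0; rewrite rmorphM rmorph0 mulf_eq0.
case/orP => /eqP // v0; apply: (inj _ s); rewrite -es eq_a opprB rmorphB !rmorphXn /= v0.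
by rewrite expr0n sub0r subrr.
Qed.

Lemma Sper_homeomorphic_Spec : homeomorphic (Sper A) (Spec A).
Proof.
exists supp, sqr_order; split.
- exact: supp_continuous.
- exact: sqr_order_continuous.
- exact: suppK.
- exact: sqr_orderK.
Qed.

(** The closure of C is the set of the prime cones that contain C. *)
Lemma SpermP (C : Sper A) :
  Sperm A C <-> forall D : Sper A, {subset cone C <= cone D} -> D = C.
Proof.
split=> [clC D sCD|maxC].
  apply: contrapT => DC.
  have : (~` [set C]) C; last exact.
  apply: (subbase_open_spec Sper_open (x := D)); first exact: closed_openC.
    exact: DC.
  move=> _ [a _ <-]; rewrite /positive_locus /=.
  by apply: contra; exact: sCD.
rewrite /Sperm /= -openC openE => D /= DC.
have [a aC aD] : exists2 a, a \in cone C & a \notin cone D.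
  apply: contrapT => nex; apply: DC; apply: maxC => a aC.
  by apply: contrapT => /negP aD; apply: nex; exists a.
have : nbhs D (positive_locus (- a)).
  apply: open_nbhs_nbhs; split; last by rewrite /positive_locus /= opprK.
  by apply: (subbase_open Sper_open); exists (- a).
apply: filterS => E; rewrite /positive_locus /= opprK => aE EC.
by move: aE; rewrite EC aC.
Qed.

Definition radical (Q : idealr A) : {pred A} := fun a => `[< exists n, a ^+ n \in Q >].

Lemma radical_ideal Q : idealr_closed (radical Q).
Proof.
have QM a u : u \in (Q : {pred A}) -> a * u \in (Q : {pred A}) by exact: idealMr.
split.
- by apply/asboolP; exists 1%N; rewrite expr1 idealr0.
- by apply/asboolP => - [n]; rewrite expr1n idealr1.
- move=> a u v /asboolP[m um] /asboolP[n vn]; apply/asboolP; exists (m + n)%N.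
  have up k : (a * u) ^+ (m + k) \in (Q : {pred A}).
    by rewrite exprD mulrC QM // exprMn QM.
  rewrite exprDn; apply: rpred_sum => i _; rewrite rpredMn //.
  have [le_i|lt_i] := leqP i n; first by rewrite mulrC QM // -addnBA.
  by rewrite QM // -(subnK (ltnW lt_i)) exprD QM.
Qed.

(** The residue domain of P is totally ordered, so of two elements a and b
    one has the smaller square, say a^2 + t^2 = b^2 modulo P.  Then a^4 is a
    multiple of a^2 + t^2, hence a^6 is a multiple of a^2 b^2 modulo P, and
    a b in the radical implies a in the radical. *)
Lemma radical_prime (P : Spec A) (Q : idealr A) :
  {subset spec_mem P <= (Q : {pred A})} -> prime_idealr_closed (radical Q).
Proof.
move=> sPQ; have [_ _ conv] := sqA.
have [rad0 _ radD] := radical_ideal Q.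
have radX a n : a ^+ n \in radical Q -> a \in radical Q.
  by move=> /asboolP[m]; rewrite -exprM => anm; apply/asboolP; exists (n * m)%N.
have key a b t : b ^+ 2 - a ^+ 2 - t ^+ 2 \in spec_mem P ->
    a * b \in radical Q -> a \in radical Q.
  move=> /sPQ pQ abQ; have [c e] := conv a t; apply: (radX _ 6).
  set p := b ^+ 2 - a ^+ 2 - t ^+ 2 in pQ.
  have -> : a ^+ 6 = c * (a * b) * (a * b) + (- (c * a ^+ 2) * p + 0).
    have -> : a ^+ 6 = c * a ^+ 2 * (a ^+ 2 + t ^+ 2) by rewrite (exprD a 4 2) e mulrAC.
    have -> : a ^+ 2 + t ^+ 2 = b ^+ 2 - p.
      by rewrite /p -[_ - t ^+ 2]addrA -opprD opprB [RHS]addrC subrK.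
    rewrite addr0 mulNr mulrBr; congr (_ - _).
    by rewrite -[RHS]mulrA -(expr2 (a * b)) exprMn [RHS]mulrA.
  apply: (radD _ _ _ abQ); apply: radD; last exact: rad0.
  by apply/asboolP; exists 1%N; rewrite expr1.
move=> a b abQ; have [dec _ _] := residue_ordered P sqA.
have [[d]|[d]] := dec (quo P (b ^+ 2 - a ^+ 2)); have [t ->] := quo_surj d => e;
  apply/orP; [left; apply: (key a b t) => // | right; apply: (key b a t)].
- by rewrite -quo_eq0 rmorphB /= e rmorphXn subrr.
- by rewrite -quo_eq0 rmorphB -(opprB (b ^+ 2)) rmorphN /= e rmorphXn subrr.
- by rewrite mulrC.
Qed.

Lemma Sperm_maximal C : Sperm A C -> Specm A (supp C).
Proof.
move=> /SpermP maxC Q sCQ.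
pose P := spec_of (radical_ideal Q) (radical_prime sCQ).
have sQP a : a \in (Q : {pred A}) -> a \in spec_mem P.
  by move=> aQ; apply/asboolP; exists 1%N; rewrite expr1.
have /maxC eC : {subset cone C <= cone (sqr_order P)}.
  by apply/supp_le_cone => a /sCQ; rewrite sqr_orderK; exact: sQP.
move=> a; apply/idP/idP; first exact: sCQ.
by move=> /sQP; rewrite -{1}(sqr_orderK P) eC.
Qed.

Lemma maximal_Sperm (P : Spec A) : Specm A P -> Sperm A (sqr_order P).
Proof.
move=> maxP; apply/SpermP => D /supp_le_cone; rewrite sqr_orderK => sPD.
have e := maxP _ sPD.
by rewrite -(suppK D); congr sqr_order; apply: Spec_ext => a; exact/esym/e.
Qed.

Lemma Sperm_card_Specm : (Sperm A #= Specm A)%card.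
Proof.
have -> : Specm A = supp @` Sperm A.
  apply/seteqP; split=> [P maxP | _ [C mC <-]]; last exact: Sperm_maximal.
  by exists (sqr_order P); [exact: maximal_Sperm | exact: sqr_orderK].
rewrite card_eq_sym; apply: inj_card_eq => C D _ _; exact: supp_inj.
Qed.

End SquareClosed.

(** * Fields ordered by their squares *)

Section OrderBySquares.
Variable F : fieldType.

(** The intermediate value property for polynomials, with x <= y expressed as:
    y - x is a square.  The condition on the sign of p(a) p(b) is symmetric,
    hence insensitive to rescaling p by a negative constant. *)
Definition square_ivt : Prop :=
  forall (p : {poly F}) (a b : F), square (b - a) -> square (- (p.[a] * p.[b])) ->
  exists x, [/\ square (x - a), square (b - x) & root p x].

Hypotheses (sqF : square_ordered F) (ivtF : square_ivt).

Definition sqr_le (x y : F) : bool := `[< square (y - x) >].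
Definition sqr_lt (x y : F) : bool := (y != x) && sqr_le x y.
Definition sqr_norm (x : F) : F := if sqr_le 0 x then x else - x.

Lemma sqr_le0 x : reflect (square x) (sqr_le 0 x).
Proof. by rewrite /sqr_le subr0; exact: asboolP. Qed.

Lemma sqr_le0_add x y : sqr_le 0 x -> sqr_le 0 y -> sqr_le 0 (x + y).
Proof.
have [_ sum _] := sqF; move=> /sqr_le0[u ->] /sqr_le0[v ->].
by apply/sqr_le0; exact: sum.
Qed.

Lemma sqr_le0_mul x y : sqr_le 0 x -> sqr_le 0 y -> sqr_le 0 (x * y).
Proof. by move=> /sqr_le0 sx /sqr_le0 sy; apply/sqr_le0; exact: squareM. Qed.

Lemma sqr_le0_anti x : sqr_le 0 x -> sqr_le x 0 -> x = 0.
Proof.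
have [_ _ inj] := sqF; move=> /sqr_le0[u ->] /asboolP[v]; rewrite sub0r => e.
by rewrite (inj u v) ?expr0n // -e subrr.
Qed.

Lemma sqr_le_sub x y : sqr_le 0 (y - x) = sqr_le x y.
Proof. by rewrite /sqr_le subr0. Qed.

Lemma sqr_le0_total x : sqr_le 0 x || sqr_le x 0.
Proof.
have [dec _ _] := sqF; apply/orP.
by have [sx|sx] := dec x; [left; apply/sqr_le0|right; apply/asboolP; rewrite sub0r].
Qed.

Lemma sqr_normN x : sqr_norm (- x) = sqr_norm x.
Proof.
rewrite /sqr_norm; have := sqr_le0_total x.
rewrite -[sqr_le x 0]sqr_le_sub sub0r.
have [x0|_] := boolP (sqr_le 0 x); have [nx0|_] := boolP (sqr_le 0 (- x)) => //= _.
  by rewrite (sqr_le0_anti x0) ?oppr0 // -sqr_le_sub sub0r.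
by rewrite opprK.
Qed.

Lemma sqr_norm_ge0 x : sqr_le 0 x -> sqr_norm x = x.
Proof. by rewrite /sqr_norm => ->. Qed.

Lemma square_ordered_real_closed : real_closed_field F.
Proof.
pose K1 : Num.RealDomain.type := HB.pack F
  (Num.IntegralDomain_isLeReal.Build F sqr_le0_add sqr_le0_mul sqr_le0_anti
    sqr_le_sub sqr_le0_total sqr_normN sqr_norm_ge0 (fun _ _ => erefl)).
pose K2 : realFieldType := HB.pack F K1.
have ivtK : Num.real_closed_axiom K2.
  move=> p a b /asboolP ab /andP[/asboolP pa /asboolP pb].
  rewrite sub0r in pa; rewrite subr0 in pb.
  have [|x [ax xb px]] := ivtF ab (p := p).
    by rewrite -mulNr; exact: squareM.
  by exists x => //; apply/andP; split; apply/asboolP.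
pose K : rcfType := HB.pack F K2 (Num.RealField_isClosed.Build K2 ivtK).
by exists K, (@idfun F : {rmorphism F -> K}); exists id.
Qed.
End OrderBySquares.

(** * Fields of fractions *)

Section Fractions.
Variable D : idomainType.
Local Notation F := {fraction D}.
Local Notation tof := (@FracField.tofrac D).

Lemma fracP (x : F) : exists a b : D, b != 0 /\ x = tof a / tof b.
Proof.
elim/quotW: x => r; exists r.1, r.2; split; first exact: denom_ratioP.
have d0 : tof r.2 != 0 by rewrite tofrac_eq0 denom_ratioP.
apply: (mulIf d0); rewrite divfK //; unlock FracField.tofrac.
rewrite -[LHS]FracField.pi_mul; apply/eqmodP => /=.
rewrite FracField.equivfE /FracField.mulf !numden_Ratio ?oner_eq0 ?mulr1 ?denom_ratioP //.
by rewrite mulrC.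
Qed.

Lemma frac_common_denom (s : seq F) :
  exists2 e : D, e != 0 & forall x, x \in s -> exists d, tof e * x = tof d.
Proof.
elim: s => [|y s [e e0 IH]]; first by exists 1; rewrite ?oner_eq0.
have [a [b [b0 ->]]] := fracP y; exists (b * e); first by rewrite mulf_neq0.
move=> x; rewrite inE => /orP[/eqP ->|/IH[d xd]].
  by exists (e * a); rewrite !rmorphM /= [LHS]mulrC mulrA divfK ?tofrac_eq0 // mulrC.
by exists (b * d); rewrite !rmorphM /= -mulrA xd.
Qed.

Hypothesis ordD : square_ordered D.

Lemma square_frac (d : D) : square (tof d) -> square d.
Proof.
have [dec _ inj] := ordD; case: (dec d) => // - [s es] [x ex].
have [a [b [b0 eab]]] := fracP x.
have e : (s * b) ^+ 2 + a ^+ 2 = 0.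
  apply/eqP; rewrite exprMn -es -tofrac_eq0 rmorphD rmorphM rmorphN /= ex eab.
  by rewrite !rmorphXn expr_div_n mulNr divfK ?addNr // expf_neq0 // tofrac_eq0.
have /eqP := inj _ _ e; rewrite mulf_eq0 (negPf b0) orbF => /eqP s0.
by exists 0; rewrite expr0n -[d]opprK es s0 expr0n oppr0.
Qed.

Lemma frac_ordered : square_ordered F.
Proof.
have [dec sum inj] := ordD.
have common (x y : F) : exists c a b : D,
    [/\ tof c != 0, x = tof a / tof c & y = tof b / tof c].
  have [c c0 H] := frac_common_denom [:: x; y].
  have [|a ea] := H x; first by rewrite inE eqxx.
  have [|b eb] := H y; first by rewrite !inE eqxx orbT.
  have C0 : tof c != 0 by rewrite tofrac_eq0.
  by exists c, a, b; split; rewrite // -?ea -?eb mulrC mulKf.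
split.
- move=> x; have [a [b [b0 ->]]] := fracP x.
  have B0 : tof b != 0 by rewrite tofrac_eq0.
  have E : tof a / tof b = tof (a * b) / tof b ^+ 2.
    by rewrite rmorphM -mulf_div divff // mulr1.
  rewrite E; have [[c e]|[c e]] := dec (a * b); [left|right];
    exists (tof c / tof b).
    by rewrite e rmorphXn expr_div_n.
  by rewrite -mulNr -rmorphN e rmorphXn expr_div_n.
- move=> x y; have [c [a [b [c0 -> ->]]]] := common x y.
  have [d e] := sum a b; exists (tof d / tof c).
  by rewrite !expr_div_n -mulrDl -!rmorphXn -rmorphD e.
- move=> x y; have [c [a [b [c0 -> ->]]]] := common x y.
  rewrite !expr_div_n -mulrDl -!rmorphXn -rmorphD => /eqP.
  rewrite tofrac_eq0 in c0; rewrite mulf_eq0 invr_eq0 /= !tofrac_eq0.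
  rewrite expf_eq0 /= (negPf c0) orbF => /eqP /inj ->.
  by rewrite rmorph0 mul0r.
Qed.

Definition monic_ivt : Prop :=
  forall (q : {poly D}) (a b : D), q \is monic -> square (b - a) ->
    square (- (q.[a] * q.[b])) ->
  exists x, [/\ square (x - a), square (b - x) & root q x].

Lemma poly_of_frac n (c : nat -> F) :
  (forall i, (i < n)%N -> exists d, c i = tof d) -> c n = 1 ->
  exists2 q : {poly D}, q \is monic & map_poly tof q = \poly_(i < n.+1) c i.
Proof.
move=> cD cn.
have /choice[d dP] : forall i, exists d, (i < n)%N -> c i = tof d.
  move=> i; have [/cD[d ->]|_] := boolP (i < n)%N; last by exists 0.
  by exists d.
exists (\poly_(i < n.+1) (if i == n then 1 else d i)).
  by rewrite monicE lead_coef_poly ?eqxx // oner_eq0.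
apply/polyP => i; rewrite coef_map !coef_poly ltnS; case: ltngtP => //= ni.
- by rewrite -dP.
- by rewrite ni cn rmorph1.
Qed.

(** With a common denominator e of a, b and the coefficients of p divided by
    the leading one, the polynomial e^n / c * p(X / e) is monic with
    coefficients in D.  Taking e to be a square keeps the order under
    multiplication by e. *)
Lemma frac_ivt : monic_ivt -> square_ivt F.
Proof.
move=> ivtD p a b [s es] [t et].
have [->|p0] := eqVneq p 0.
  exists a; rewrite root0 subrr; split=> //; first by exists 0; rewrite expr0n.
  by exists s.
set c := lead_coef p; pose n := (size p).-1.
have c0 : c != 0 by rewrite lead_coef_eq0.
have sp : size p = n.+1 by rewrite prednK // size_poly_gt0.
have [e0 e00 H] := frac_common_denom (a :: b :: [seq x / c | x <- p]).
pose e := tof (e0 ^+ 2).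
have eE : e = tof e0 ^+ 2 by exact: rmorphXn.
have e_neq0 : e != 0 by rewrite tofrac_eq0 expf_neq0.
have {}H x : x \in a :: b :: [seq x / c | x <- p] -> exists d, e * x = tof d.
  by move=> /H[d xd]; exists (e0 * d); rewrite /e expr2 !rmorphM /= -mulrA xd.
have [|al eal] := H a; first by rewrite inE eqxx.
have [|be ebe] := H b; first by rewrite !inE eqxx orbT.
pose c' i := e ^+ n / c * p`_i / e ^+ i.
have [||q qm eq] := @poly_of_frac n c'.
- move=> i lt_i; have [|d ed] := H (p`_i / c).
    rewrite !inE; apply/or3P; constructor 3; apply: (map_f (fun x => x / c)).
    by rewrite mem_nth // sp ltnS ltnW.
  exists (e0 ^+ 2 ^+ (n - i).-1 * d); rewrite rmorphM rmorphXn -/e /= -ed.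
  have ei0 : e ^+ i != 0 by rewrite expf_neq0.
  apply: (mulIf ei0); rewrite /c' divfK //.
  have -> : e ^+ n = e ^+ (n - i).-1 * e * e ^+ i.
    by rewrite -exprSr prednK ?subn_gt0 // -exprD subnK // ltnW.
  rewrite -!mulrA; do 2! congr (_ * _).
  by rewrite [LHS]mulrC [c^-1 * _]mulrC -mulrA.
- rewrite /c' -[p`_n]/(p`_(size p).-1) -lead_coefE -/c divfK // divff //.
  by rewrite expf_neq0.
have q_horner x : (map_poly tof q).[e * x] = e ^+ n / c * p.[x].
  rewrite eq horner_poly horner_coef sp mulr_sumr; apply: eq_bigr => i _.
  by rewrite /c' exprMn !mulrA divfK // expf_neq0.
have tof_horner x d : e * x = tof d -> tof q.[d] = e ^+ n / c * p.[x].
  by move=> xd; rewrite -q_horner xd horner_map.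
have sq_div x y d d' : e * x = tof d -> e * y = tof d' ->
    square (d' - d) <-> square (y - x).
  move=> xd yd; have -> : y - x = tof (d' - d) / e.
    by rewrite rmorphB /= -xd -yd -mulrBr mulrC mulKf.
  split=> [[r ->]|[r er]].
    by exists (tof r / tof e0); rewrite rmorphXn expr_div_n eE.
  apply: square_frac; exists (r * tof e0); rewrite exprMn -er -eE divfK //.
have [||xi [sq1 sq2 /rootP rx]] := ivtD q al be qm.
- by apply/(sq_div a b al be); [..|exists s].
- apply: square_frac; exists (e ^+ n / c * t).
  rewrite rmorphN rmorphM /= (tof_horner _ _ eal) (tof_horner _ _ ebe).
  by rewrite mulrACA -mulrN -expr2 et -exprMn.
have exi : e * (tof xi / e) = tof xi by rewrite mulrC divfK.
exists (tof xi / e); split; [exact/(sq_div _ _ _ _ eal exi) | |].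
  exact/(sq_div _ _ _ _ exi ebe).
have /eqP := tof_horner _ _ exi.
rewrite rx rmorph0 eq_sym mulf_eq0 mulf_eq0 invr_eq0 (negPf c0).
by rewrite expf_eq0 (negPf e_neq0) andbF.
Qed.

End Fractions.

(** * Rings of real functions stable under limits *)

Section FunctionRing.
Variables (R : realType) (T : topologicalType) (A : comNzRingType).
Variable ev : T -> {rmorphism A -> R}.

Definition points_separate := forall a b : A, (forall x, ev x a = ev x b) -> a = b.

(** The condition on Phi is imposed only along the values of the given
    elements: Phi need not be continuous outside the closure of their joint
    range, as for the quotient a^2 / b with 0 <= a <= b. *)
Definition limit_stable := forall (I : finType) (f : I -> A) (Phi : (I -> R) -> R),
  (forall (F : set_system T), ProperFilter F -> forall l : I -> R,
     (forall i, ev x (f i) @[x --> F] --> l i) ->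
     Phi (fun i => ev x (f i)) @[x --> F] --> Phi l) ->
  exists a, forall x, ev x a = Phi (fun i => ev x (f i)).

Hypotheses (sep : points_separate) (stab : limit_stable).

Lemma limit_stable2 (a b : A) (phi : R -> R -> R) :
  (forall (F : set_system T), ProperFilter F -> forall l m : R,
     ev x a @[x --> F] --> l -> ev x b @[x --> F] --> m ->
     phi (ev x a) (ev x b) @[x --> F] --> phi l m) ->
  exists c, forall x, ev x c = phi (ev x a) (ev x b).
Proof.
move=> phiP; apply: (stab (f := fun i : bool => if i then a else b)
  (Phi := fun l => phi (l true) (l false))) => F FF l fl.
by apply: phiP; [exact: (fl true) | exact: (fl false)].
Qed.

Lemma stable_sqrt a : exists u, forall x, ev x u = Num.sqrt (ev x a).
Proof.
apply: (limit_stable2 (b := a) (phi := fun l _ => Num.sqrt l)) => F FF l _ al _.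
by apply: continuous_cvg al; exact: sqrt_continuous.
Qed.

Definition le_pt (a b : A) : Prop := forall x, ev x a <= ev x b.

Lemma le_pt_square a b : le_pt a b -> square (b - a).
Proof.
move=> ab; have [u uE] := stable_sqrt (b - a); exists u.
by apply: sep => x; rewrite rmorphXn uE sqr_sqrtr // rmorphB subr_ge0.
Qed.

(** The square of the square root of a - b is its positive part, and
    min(a, b) = a - (a - b)^+. *)
Lemma min_pt a b : exists m, forall x, ev x m = Num.min (ev x a) (ev x b).
Proof.
have [u uE] := stable_sqrt (a - b); exists (a - u ^+ 2) => x.
rewrite rmorphB rmorphXn /= uE rmorphB /=; case: leP => ab.
  by rewrite ler0_sqrtr ?subr_le0 // expr0n subr0.
by rewrite sqr_sqrtr ?subr_ge0 ?ltW // opprB addrC subrK.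
Qed.

Lemma max_pt a b : exists m, forall x, ev x m = Num.max (ev x a) (ev x b).
Proof.
have [m mE] := min_pt a b; exists (a + b - m) => x.
by rewrite rmorphB rmorphD /= mE -(addr_max_min (ev x a)) addrK.
Qed.

(** The quotient a^2 / b is at most b, so it tends to 0 where b does, in
    accordance with the convention 0^-1 = 0. *)
Lemma bounded_division a b : le_pt 0 a -> le_pt a b -> exists c, a ^+ 2 = b * c.
Proof.
move=> a0 ab; have [c cE] : exists c, forall x, ev x c = ev x a ^+ 2 / ev x b.
  apply: (limit_stable2 (phi := fun l m => l ^+ 2 / m)) => F FF l m al bm.
  have [m0|m0] := eqVneq m 0; last first.
    by apply: cvgM; [exact: (cvg_pow al) | exact: cvgV].
  rewrite m0 invr0 mulr0; rewrite m0 in bm.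
  apply: (squeeze_cvgr _ (cvg_cst 0) bm); apply: nearW => x.
  have a0x : 0 <= ev x a by have := a0 x; rewrite rmorph0.
  have abx := ab x; have b0x := le_trans a0x abx.
  rewrite divr_ge0 ?sqr_ge0 //=; have [->|bx0] := eqVneq (ev x b) 0.
    by rewrite invr0 mulr0.
  have bx : 0 < ev x b by rewrite lt_neqAle eq_sym bx0.
  by rewrite ler_pdivrMr // -expr2 ler_pXn2r.
exists c; apply: sep => x; rewrite rmorphM rmorphXn /= cE.
have [bx0|bx0] := eqVneq (ev x b) 0; last by rewrite mulrC divfK.
have := a0 x; rewrite rmorph0 bx0 mul0r => a0x.
suff -> : ev x a = 0 by rewrite expr0n.
by apply/eqP; rewrite eq_le a0x -bx0 ab.
Qed.

Lemma orthogonal_squares a : exists u v,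
  [/\ a = u ^+ 2 - v ^+ 2, u * v = 0 & forall x, ev x v = Num.sqrt (- ev x a)].
Proof.
have [u uE] := stable_sqrt a; have [v vE] := stable_sqrt (- a).
exists u, v; split; [apply: sep => x..|].
- rewrite rmorphB !rmorphXn /= uE vE rmorphN /=; case: (leP 0 (ev x a)) => ax.
    by rewrite sqr_sqrtr // ler0_sqrtr ?oppr_le0 // expr0n subr0.
  by rewrite ler0_sqrtr ?ltW // sqr_sqrtr ?oppr_ge0 ?ltW // expr0n sub0r opprK.
- rewrite rmorphM rmorph0 /= uE vE rmorphN; case: (leP 0 (ev x a)) => ax.
    by rewrite [X in _ * X]ler0_sqrtr ?mulr0 // oppr_le0.
  by rewrite ler0_sqrtr ?mul0r // ltW.
- by move=> x; rewrite vE rmorphN.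
Qed.

Lemma function_ring_square_closed : square_closed A.
Proof.
split=> [a|a b|a b].
- by have [u [v [eq_a uv _]]] := orthogonal_squares a; exists u, v.
- have [|c e] := @le_pt_square 0 (a ^+ 2 + b ^+ 2).
    by move=> x; rewrite rmorph0 rmorphD !rmorphXn addr_ge0 ?sqr_ge0.
  by exists c; rewrite -e subr0.
- have [||c e] := @bounded_division (a ^+ 2) (a ^+ 2 + b ^+ 2).
  + by move=> x; rewrite rmorph0 rmorphXn sqr_ge0.
  + by move=> x; rewrite rmorphD lerDl rmorphXn sqr_ge0.
  by exists c; rewrite mulrC -e -exprM.
Qed.

Lemma le_pt_f_ring : f_ring le_pt.
Proof.
split.
- split=> [a x|a b ab ba|a b c ab bc x]; [by [] | | exact: le_trans (ab x) (bc x)].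
  by apply: sep => x; apply/eqP; rewrite eq_le ab ba.
- move=> a b; have [m mE] := min_pt a b; have [M ME] := max_pt a b.
  split; [exists m | exists M]; split=> [x|x|z za zb x].
  + by rewrite mE ge_min lexx.
  + by rewrite mE ge_min lexx orbT.
  + by rewrite mE le_min za zb.
  + by rewrite ME le_max lexx.
  + by rewrite ME le_max lexx orbT.
  + by rewrite ME ge_max za zb.
- by move=> a b c ab x; rewrite !rmorphD lerD2r.
- by move=> a b a0 b0 x; have := a0 x; have := b0 x; rewrite rmorphM rmorph0; nra.
- move=> a b c [a0 b0 ab0] c0.
  have disj x : ev x a = 0 \/ ev x b = 0.
    have [m mE] := min_pt a b.
    have /(_ x) : le_pt m 0 by apply: ab0 => y; rewrite mE ge_min lexx ?orbT.
    rewrite mE rmorph0; have := a0 x; have := b0 x; rewrite rmorph0.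
    by case: (leP (ev x a)) => _ ? ? ?;
      [left|right]; apply/eqP; rewrite eq_le; apply/andP.
  split=> [x|//|z zca zb x].
    by have := c0 x; have := a0 x; rewrite rmorphM rmorph0; nra.
  have [ax|bx] := disj x; last by have := zb x; rewrite bx rmorph0.
  by have := zca x; rewrite rmorphM ax mulr0 rmorph0.
Qed.


Lemma nat_lead_map (B C : comNzRingType) (g : {rmorphism B -> C}) n k (q : {poly B}) :
  nat_lead n k q -> nat_lead n k (map_poly g q).
Proof.
move=> [sq lq]; split; first exact: leq_trans (size_poly _ _) sq.
by rewrite coef_map lq /= rmorph_nat.
Qed.

(** The i-th virtual root, as a function of the coefficients, is compatible
    with limits. *)
Lemma vroots_pt n k (q : {poly A}) : nat_lead n k q ->
  exists2 s : seq A, size s = n &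
    forall x, map (ev x) s = vroots n (map_poly (ev x) q).
Proof.
move=> nq; pose f (i : 'I_n.+1) := q`_i.
pose pol (l : 'I_n.+1 -> R) : {poly R} := \poly_(i < n.+1) l (inord i).
have coef_pol l i (lt_i : (i < n.+1)%N) : (pol l)`_i = l (inord i).
  by rewrite coef_poly lt_i.
have polE x : pol (fun i => ev x (f i)) = map_poly (ev x) q.
  apply/polyP => i; rewrite coef_poly coef_map /f; case: ltnP => lt_i.
    by rewrite inordK.
  have [sq _] := nq; rewrite [q`_i]nth_default; last exact: leq_trans sq lt_i.
  by apply/esym; exact: rmorph0.
have nat_pol l : l ord_max = k.+1%:R -> nat_lead n k (pol l).
  move=> lk; split; first exact: size_poly.
  by rewrite coef_pol // -lk; congr l; apply/val_inj; rewrite /= inordK.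
have /choice[r rE] : forall j : nat, exists a, forall x,
    ev x a = (vroots n (map_poly (ev x) q))`_j.
  move=> j.
  have [|a aE] := stab (f := f) (Phi := fun l => (vroots n (pol l))`_j).
    move=> F FF l fl.
    have lk : l ord_max = k.+1%:R.
      apply: (cvg_unique (@norm_hausdorff _ R) (fl ord_max)).
      have E : (fun x => ev x (f ord_max)) = cst k.+1%:R.
        by apply/funext => x; case: nq => _ e; rewrite /f /= e rmorph_nat.
      by rewrite E; exact: cvg_cst.
    apply: cvg_vroots => [x||i].
    - by exists k; rewrite polE; exact: nat_lead_map.
    - by exists k; exact: nat_pol.
    case: (ltnP i n.+1) => lt_i.
      rewrite coef_pol //; under eq_fun do rewrite coef_pol //; exact: fl.
    rewrite coef_poly ltnNge lt_i /=; under eq_fun do rewrite coef_poly ltnNge lt_i /=.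
    exact: cvg_cst.
  by exists a => x; rewrite aE polE.
exists (mkseq r n); first exact: size_mkseq.
move=> x; apply: (@eq_from_nth _ 0); first by rewrite size_map size_mkseq size_vroots.
move=> j; rewrite size_map size_mkseq => lt_j.
by rewrite (nth_map 0) ?size_mkseq // nth_mkseq // rE.
Qed.

Lemma le_pt_morph (K : rcfType) (g : {rmorphism A -> K}) a b :
  le_pt a b -> g a <= g b.
Proof.
by move=> /le_pt_square[c e]; rewrite -subr_ge0 -rmorphB e rmorphXn sqr_ge0.
Qed.

(** By induction on the degree, using the virtual roots of q' in the ring: the
    inequalities that define virtual roots hold at every point, so g preserves
    them, and [interlace_roots] applies over K. *)
Lemma vroots_cover (K : rcfType) (g : {rmorphism A -> K}) n k (q : {poly A}) (s : seq A) :
  nat_lead n k q -> size s = n ->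
  (forall x, map (ev x) s = vroots n (map_poly (ev x) q)) ->
  forall y, root (map_poly g q) y -> y \in map g s.
Proof.
elim: n k q s => [|n IH] k q s nq size_s sE y.
  have [sq lq] := nat_lead_map g nq.
  by rewrite (size1_polyC sq) lq rootC pnatr_eq0.
have [k' nq'] := nat_lead_deriv nq; have [t size_t tE] := vroots_pt nq'.
have map_ev (h : seq A) x i : (i < size h)%N -> (map (ev x) h)`_i = ev x h`_i.
  by move=> lt_i; rewrite (nth_map 0).
have nat_ev x := nat_lead_map (ev x) nq.
have sorted_t : sorted <=%R (map g t).
  apply/(sortedP 0) => i; rewrite size_map => lt_i.
  rewrite !(nth_map 0) //; last exact: ltnW.
  apply: le_pt_morph => x; rewrite -!map_ev ?tE //; last exact: ltnW.
  have [ss _] := vrootsP (nat_lead_map (ev x) nq').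
  by move/(sortedP 0): ss; apply; rewrite size_vroots -size_t.
have map_endpoints (K' : comNzRingType) (h : {rmorphism A -> K'}) :
    endpoints n.+1 (map_poly h q) (map h t) = map h (endpoints n.+1 q t).
  rewrite /endpoints map_cons map_rcons rmorphN.
  suff -> : root_bound n.+1 (map_poly h q) (map h t) = h (root_bound n.+1 q t) by [].
  rewrite /root_bound !rmorphD rmorph1 !rmorph_sum big_map.
  congr (_ + _ + _); apply: eq_bigr => i _; rewrite rmorphD rmorph1 rmorphXn //.
  by rewrite coef_map.
have inter : interlace n (map_poly g q) (map g t) (map g s).
  move=> i le_i.
  rewrite map_endpoints !(nth_map 0) ?size_endpoints ?size_t ?size_s //; last exact: leqW.
  have vx x : virtual_root (map_poly (ev x) q) (ev x (endpoints n.+1 q t)`_i)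
      (ev x (endpoints n.+1 q t)`_i.+1) (ev x s`_i).
    have := vroots_interlace (nat_ev x) le_i.
    rewrite deriv_map -tE map_endpoints -sE.
    by rewrite !(nth_map 0) ?size_endpoints ?size_t ?size_s // leqW.
  split; rewrite ?horner_map -?rmorphXn -?rmorphM; apply: le_pt_morph => x;
    have [h1 h2 h3 h4] := vx x.
  - exact: h1.
  - exact: h2.
  - by rewrite rmorphXn rmorphM /= -!horner_map.
  - by rewrite rmorphXn rmorphM /= -!horner_map.
have [|||_ cover] := interlace_roots (nat_lead_map g nq) sorted_t _ _ _ inter.
- by rewrite size_map.
- by rewrite size_map.
- by move=> z; rewrite deriv_map; exact: (IH _ _ _ nq' size_t tE).
exact: cover.
Qed.

Section Residue.
Variable P : Spec A.
Local Notation D := (residue P).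

Let ordD : square_ordered D := residue_ordered P function_ring_square_closed.

Lemma monic_lift (q : {poly D}) : q \is monic ->
  exists2 Q : {poly A}, nat_lead (size q).-1 0 Q & map_poly (quo P) Q = q.
Proof.
move=> qm; have /choice[r rE] : forall d : D, exists a, d = quo P a by exact: quo_surj.
pose n := (size q).-1.
have sq : size q = n.+1 by rewrite prednK // size_poly_gt0 monic_neq0.
exists (\poly_(i < n.+1) (if i == n then 1 else r q`_i)).
  by split; [exact: size_poly | rewrite coef_poly ltnSn eqxx].
apply/polyP => i; rewrite coef_map coef_poly ltnS; case: ltngtP => /= ni.
- by rewrite -rE.
- by rewrite rmorph0 nth_default // sq.
- by rewrite rmorph1 ni -(monicP qm) lead_coefE.
Qed.

(** Let h = q(a) q(b) and let v be the square root of the negative part of h.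
    The product of v with the values of q at the clamped virtual roots
    vanishes at every point: v is nonzero only where q changes sign between a
    and b.  If v is the factor that vanishes modulo P, then h >= 0 modulo P,
    so h = 0 modulo P and a or b is a root. *)
Lemma residue_monic_ivt : monic_ivt D.
Proof.
move=> q a b qm [d ed] [d' ed'].
have [Q nQ eQ] := monic_lift qm; have [s size_s sE] := vroots_pt nQ.
have [al eal] := quo_surj a; have [si esi] := quo_surj d.
(* Adding a square to a lift of a makes be >= al at every point, so that the
   clamping below makes sense. *)
pose be := al + si ^+ 2.
have ebe : b = quo P be by rewrite rmorphD rmorphXn /= -esi -ed -eal addrC subrK.
have clampP c : exists m, forall x,
    ev x m = Num.max (ev x al) (Num.min (ev x c) (ev x be)).
  have [m mE] := min_pt c be; have [M ME] := max_pt al m.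
  by exists M => x; rewrite ME mE.
have /choice[cl clE] := clampP.
have le_ab x : ev x al <= ev x be by rewrite rmorphD lerDl rmorphXn sqr_ge0.
pose h := Q.[al] * Q.[be].
have [u [v [h_eq _ vE]]] := orthogonal_squares h.
have prod0 : v * \prod_(c <- s) Q.[cl c] = 0.
  apply: sep => x; rewrite rmorphM rmorph0 vE /=.
  have [h0|h0] := leP 0 (ev x h); first by rewrite ler0_sqrtr ?oppr_le0 // mul0r.
  have hab : (map_poly (ev x) Q).[ev x al] * (map_poly (ev x) Q).[ev x be] <= 0.
    by rewrite !horner_map -rmorphM ltW.
  have [r rab qr] := polyrcf.poly_ivt (le_ab x) hab.
  have [_ cover] := vrootsP (nat_lead_map (ev x) nQ).
  have := cover _ qr; rewrite -sE => /mapP[c cs rc].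
  apply/eqP; rewrite mulf_eq0; apply/orP; right.
  rewrite rmorph_prod prodf_seq_eq0; apply/hasP; exists c => //=.
  rewrite -horner_map clE -rc.
  move: rab; rewrite in_itv /= => /andP[ra rb].
  by rewrite (min_idPl rb) (max_idPr ra); exact/eqP/rootP.
have qh : quo P h = q.[a] * q.[b] by rewrite eal ebe -eQ !horner_map -rmorphM.
have sq_ab : square (b - a) by exists d.
have sq_0 : square (0 : D) by exists 0; rewrite expr0n.
have /eqP := congr1 (quo P) prod0; rewrite rmorphM rmorph0 mulf_eq0.
case/orP => [/eqP v0|].
  have [_ _ inj] := ordD.
  have u0 : quo P u = 0.
    apply: (inj _ d'); rewrite -ed' -qh h_eq rmorphB !rmorphXn /= v0 expr0n subr0.
    by rewrite subrr.
  have /eqP : q.[a] * q.[b] = 0.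
    by rewrite -qh h_eq rmorphB !rmorphXn /= u0 v0 expr0n subr0.
  rewrite mulf_eq0 => /orP[ra|rb]; [exists a | exists b]; split=> //; by rewrite subrr.
rewrite rmorph_prod prodf_seq_eq0 => /hasP[c cs /= rc].
exists (quo P (cl c)); split.
- rewrite eal -rmorphB; have [|w ->] := @le_pt_square al (cl c).
    by move=> x; rewrite clE le_max lexx.
  by exists (quo P w); rewrite rmorphXn.
- rewrite ebe -rmorphB; have [|w ->] := @le_pt_square (cl c) be.
    by move=> x; rewrite clE ge_max le_ab ge_min lexx orbT.
  by exists (quo P w); rewrite rmorphXn.
- by rewrite rootE -eQ horner_map.
Qed.

Lemma residue_real_closed_field :
  integrally_closed D /\ real_closed_field {fraction D}.
Proof.
have [K [f bij_f]] :=
  square_ordered_real_closed (frac_ordered ordD) (frac_ivt ordD residue_monic_ivt).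
split; last by exists K, f.
move=> y [p pm py]; have [Q nQ eQ] := monic_lift pm.
have [s size_s sE] := vroots_pt nQ.
pose g : {rmorphism A -> K} := f \o (@FracField.tofrac D) \o quo P.
have := vroots_cover (g := g) nQ size_s sE (y := f y).
rewrite (_ : map_poly g Q = map_poly f (map_poly (@FracField.tofrac D) p)); last first.
  by rewrite -eQ -!map_poly_comp.
rewrite fmorph_root => /(_ py) /mapP[c _ /(bij_inj bij_f) ->].
by exists (quo P c).
Qed.

End Residue.

Theorem function_ring_real_closed : real_closed_ring A.
Proof.
exists le_pt; split.
- exact: le_pt_f_ring.
- move=> a; split=> [/le_pt_square|[b ->] x]; first by rewrite subr0.
  by rewrite rmorph0 rmorphXn sqr_ge0.
- exact: bounded_division.
- exact: residue_real_closed_field.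
Qed.

End FunctionRing.

(** * Regulated functions *)

Section Regulated.
Variable R : realType.
Local Notation T := (unit_itv R).

Section Superposition.
Variables (I : finType) (f : I -> T -> R) (Phi : (I -> R) -> R).
Hypothesis PhiP : forall F : set_system T, ProperFilter F -> forall l : I -> R,
  (forall i, f i x @[x --> F] --> l i) ->
  Phi (f^~ x) @[x --> F] --> Phi l.

Lemma superposition_cvg (F : set_system T) : Filter F ->
  (forall i, exists l : R, f i @ F --> l) ->
  exists l : R, Phi (f^~ x) @[x --> F] --> l.
Proof.
(* An improper filter converges to every point. *)
move=> FF /choice[l fl]; have [F0|F0] := pselect (F set0).
  by exists 0 => V _; apply: (@filterS _ F _ set0 _ _ F0) => x [].
by exists (Phi l); apply: PhiP.
Qed.

Lemma superposition_regulated : (forall i, regulated (f i)) ->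
  regulated (fun x => Phi (f^~ x)).
Proof.
move=> rf; split=> c hc; apply: superposition_cvg => i.
- by have [+ _] := rf i; apply.
- by have [_] := rf i; apply.
Qed.

Lemma superposition_discontinuities :
  discontinuities (fun x => Phi (f^~ x)) `<=` \bigcup_(i in setT) discontinuities (f i).
Proof.
move=> c /= nc; apply: contrapT => nf; apply: nc.
apply: (PhiP (nbhs_pfilter c)) => i.
by apply: contrapT => nfi; apply: nf; exists i.
Qed.

End Superposition.

Definition reg_eval (x : T) (f : Reg R) : R := f x.

Lemma reg_eval_is_zmod_morphism x : zmod_morphism (reg_eval x).
Proof. by []. Qed.

Lemma reg_eval_is_monoid_morphism x : monoid_morphism (reg_eval x).
Proof. by []. Qed.

HB.instance Definition _ x := GRing.isZmodMorphism.Build (Reg R) R (reg_eval x)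
  (reg_eval_is_zmod_morphism x).
HB.instance Definition _ x := GRing.isMonoidMorphism.Build (Reg R) R (reg_eval x)
  (reg_eval_is_monoid_morphism x).

Definition rego_eval (x : T) (f : Rego R) : R := f x.

Lemma rego_eval_is_zmod_morphism x : zmod_morphism (rego_eval x).
Proof. by []. Qed.

Lemma rego_eval_is_monoid_morphism x : monoid_morphism (rego_eval x).
Proof. by []. Qed.

HB.instance Definition _ x := GRing.isZmodMorphism.Build (Rego R) R (rego_eval x)
  (rego_eval_is_zmod_morphism x).
HB.instance Definition _ x := GRing.isMonoidMorphism.Build (Rego R) R (rego_eval x)
  (rego_eval_is_monoid_morphism x).

Definition reg_at (x : T) : {rmorphism Reg R -> R} := reg_eval x.
Definition rego_at (x : T) : {rmorphism Rego R -> R} := rego_eval x.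

Lemma reg_separated : points_separate reg_at.
Proof. by move=> f g fg; apply/val_inj/funext => x; exact: fg. Qed.

Lemma rego_separated : points_separate rego_at.
Proof. by move=> f g fg; apply/val_inj/funext => x; exact: fg. Qed.

Lemma reg_limit_stable : limit_stable reg_at.
Proof.
move=> I f Phi PhiP.
have rg : (fun x => Phi (fun i => f i x)) \in @reg_pred R.
  apply/asboolP; apply: (superposition_regulated PhiP) => i.
  exact/asboolP/(valP (f i)).
by exists (MkReg rg).
Qed.

Lemma rego_limit_stable : limit_stable rego_at.
Proof.
move=> I f Phi PhiP.
have fP i : regulated (f i) /\ finite_set (discontinuities (f i)).
  exact/asboolP/(valP (f i)).
have rg : (fun x => Phi (fun i => f i x)) \in @rego_pred R.
  apply/asboolP; split.
    by apply: (superposition_regulated PhiP) => i; case: (fP i).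
  apply: sub_finite_set (superposition_discontinuities PhiP) _.
  by apply: bigcup_finite => [|i _]; [exact: finite_finset | case: (fP i)].
by exists (MkRego rg).
Qed.

End Regulated.

Theorem theorem6p6 (R : realType) :
  [/\ real_closed_ring (Rego R),
      homeomorphic (Sper (Rego R)) (Spec (Rego R))
    & (Sperm (Reg R) #= Specm (Reg R))%card].
Proof.
have sqRego := function_ring_square_closed (@rego_separated R) (@rego_limit_stable R).
have sqReg := function_ring_square_closed (@reg_separated R) (@reg_limit_stable R).
split.
- exact: (function_ring_real_closed (@rego_separated R) (@rego_limit_stable R)).
- exact: Sper_homeomorphic_Spec.
- exact: Sperm_card_Specm.
Qed.
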